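(* Let $A=[A_{i,j}]_{i,j\in E}$ be the transition operator of an irreducible Markov chain with countably infinite state space $E$, where $E$ is identified with $\mathbb{Z}_+$ by an enumeration, and suppose that $A$ acts on $c$ (i.e. $A$ maps $c$ into $c$). Then $A$ is not supercyclic on $c$. Moreover, if the Markov chain is positive recurrent, the result remains valid with $c$ replaced by $c_0$: if the chain is positive recurrent and $A$ acts on $c_0$ (i.e. $A$ maps $c_0$ into $c_0$), then $A$ is not supercyclic on $c_0$.
   Context: $c$ is the Banach space of convergent complex sequences $(w_n)_{n\ge 0}$ with the supremum norm, and $c_0\subset c$ is the closed subspace of sequences converging to $0$. The transition operator $A$ is a stochastic matrix ($A_{i,j}\ge 0$, $\sum_j A_{i,j}=1$ for every $i$) acting on sequences by $(Ax)_i=\sum_j A_{i,j}x_j$. The chain is irreducible if for each pair $i,j$ there is a nonnegative integer $n$ with $(A^n)_{i,j}>0$. It is positive recurrent if it has an invariant probability distribution, i.e. there is a probability vector $u\in l^1$ with $uA=u$ (where $(uA)_j=\sum_i u_iA_{i,j}$). A linear operator $T:X\to X$ on a separable complex Banach space $X$ is supercyclic if there exists $x\in X$ such that $\{\lambda T^n x : n\in\mathbb{N},\ \lambda\in\mathbb{C}\}$ is dense in $X$. *)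

(* Defs.v *)
From HB Require Import structures.
From mathcomp Require Import all_boot all_order all_algebra.
From mathcomp Require Import all_classical all_reals all_analysis.
From mathcomp Require Import complex.

Set Implicit Arguments.
Unset Strict Implicit.
Unset Printing Implicit Defensive.

Import Order.TTheory GRing.Theory Num.Theory.
Import numFieldNormedType.Exports.

Local Open Scope classical_set_scope.
Local Open Scope ring_scope.
Local Open Scope complex_scope.

(* The topology of the complex numbers is carried by the alias R[i]^o. *)
Notation cseq R := (nat -> R[i]^o).

Section Markov.
Variable R : realType.
Implicit Types A : nat -> nat -> R.

(* A is the transition matrix, with the countably infinite state space already
   identified with nat. *)
Definition stochastic A :=
  (forall i j, 0 <= A i j) /\ (forall i, series (A i) @ \oo --> (1 : R)).

(* The entries of A ^ n. For stochastic A all the series involved converge, so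
   that limn is their sum. *)
Fixpoint mxpow A n : nat -> nat -> R :=
  if n is m.+1 then
    fun i j => limn (series (fun k => A i k * mxpow A m k j))
  else fun i j => (i == j)%:R.

Definition irreducible A := forall i j, exists n, 0 < mxpow A n i j.

Definition positive_recurrent A :=
  exists u : nat -> R,
    [/\ forall i, 0 <= u i,
        series u @ \oo --> (1 : R) &
        forall j, series (fun i => u i * A i j) @ \oo --> u j].

(* For stochastic A the series converges as soon as x is bounded, hence on c
   and on c_0 (see is_cvg_mxact), and limn is its sum. *)
Definition mxact A (x : cseq R) : cseq R :=
  fun i => limn (series (fun j => (A i j)%:C * x j : R[i]^o)).

End Markov.

Definition supercyclic (R : realType) (X : normedModType R[i])
    (T : {linear X -> X}) :=
  exists x : X,
    dense [set lambda *: iter n T x | lambda in [set: R[i]] & n in [set: nat]].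

Section SupNorm.
Variable R : realType.
Implicit Types (x y : cseq R) (l : R[i]).

(* The norm of a normedModType over R[i] takes values in R[i], hence the
   embedding of the real supremum; Re only retypes the real number `|x n|.
   The supremum is meaningful when x is bounded. *)
Definition supnorm x : R[i] := (sup (range (fun n => complex.Re `|x n|)))%:C.

Let ReN (z : R[i]^o) : (complex.Re `|z|)%:C = `|z|.
Proof. by case: z. Qed.

Let ReN_ge0 (z : R[i]^o) : 0 <= complex.Re `|z|.
Proof. by rewrite -ler0c ReN. Qed.

Lemma cvgn_bounded x : cvgn x -> exists M : R, forall n, complex.Re `|x n| <= M.
Proof.
move=> /cvg_seq_bounded/pinfty_ex_gt0[M M0 xM]; exists (complex.Re M) => n.
by rewrite -lecR ReN RRe_real ?gtr0_real//; exact: xM.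
Qed.

Let bnd x := has_ubound (range (fun n => complex.Re `|x n|)).

Let cvgn_bnd x : cvgn x -> bnd x.
Proof. by move=> /cvgn_bounded[M xM]; exists M => _ [n _ <-]. Qed.

Lemma supnorm_ge x n : cvgn x -> `|x n| <= supnorm x.
Proof.
by move=> /cvgn_bnd bx; rewrite -ReN lecR; apply: ub_le_sup => //; exists n.
Qed.

Lemma supnorm_le x (M : R) :
  (forall n, `|x n| <= M%:C) -> supnorm x <= M%:C.
Proof.
move=> xM; rewrite lecR; apply: ge_sup; first by exists (complex.Re `|x 0%N|), 0%N.
by move=> _ [n _ <-]; rewrite -lecR ReN.
Qed.

Lemma supnormD x y : cvgn x -> cvgn y ->
  supnorm (x + y) <= supnorm x + supnorm y.
Proof.
move=> cx cy; rewrite -rmorphD; apply: supnorm_le => n; rewrite rmorphD.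
by apply: le_trans (ler_normD _ _) _; apply: lerD; exact: supnorm_ge.
Qed.

Lemma supnorm0_eq0 x : cvgn x -> supnorm x = 0 -> x = 0.
Proof.
move=> cx x0; apply/funext => n; apply/eqP; rewrite -normr_le0 -x0.
exact: supnorm_ge.
Qed.

Lemma supnorm_ge0 x : cvgn x -> 0 <= supnorm x.
Proof. by move=> cx; apply: le_trans (supnorm_ge 0 cx). Qed.

Lemma supnormZ l x : cvgn x -> supnorm (l *: x) = `|l| * supnorm x.
Proof.
have cZ k z : cvgn z -> cvgn (k *: z : cseq R) by exact: is_cvgZl_tmp.
have le k z : cvgn z -> supnorm (k *: z) <= `|k| * supnorm z.
  move=> cz; rewrite -[`|k|](ReN k) -rmorphM; apply: supnorm_le => n.
  by rewrite rmorphM [X in X * _](ReN k) normrZ ler_wpM2l ?supnorm_ge.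
move=> cx; apply/le_anti/andP; split; first exact: le.
have [l0|l0] := eqVneq l 0.
  have -> : `|l| * supnorm x = 0 by rewrite l0 normr0 mul0r.
  exact: supnorm_ge0 (cZ l x cx).
have := le l^-1 _ (cZ l x cx); rewrite scalerA mulVf// scale1r normfV.
by rewrite ler_pdivlMl ?normr_gt0.
Qed.

End SupNorm.

Section Spaces.
Variable R : realType.

Definition c_pred : {pred cseq R} := fun x => `[< cvgn x >].
Definition c0_pred : {pred cseq R} := fun x => `[< x @ \oo --> (0 : R[i]^o) >].

Lemma c_submod_closed : submod_closed c_pred.
Proof.
split=> [|l x y /asboolP cx /asboolP cy]; first by apply/asboolP; exact: is_cvg_cst.
by apply/asboolP; exact: is_cvgD (is_cvgZl_tmp cx) cy.
Qed.

Lemma c0_submod_closed : submod_closed c0_pred.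
Proof.
split=> [|l x y /asboolP x0 /asboolP y0]; first by apply/asboolP; exact: cvg_cst.
apply/asboolP; have := cvgD (cvgZl_tmp (k := l) x0) y0.
by rewrite scaler0 addr0; apply.
Qed.

HB.instance Definition _ := GRing.isSubmodClosed.Build _ _ c_pred
  c_submod_closed.
HB.instance Definition _ := GRing.isSubmodClosed.Build _ _ c0_pred
  c0_submod_closed.

(* The spaces c and c_0, with the supremum norm. *)
Record c_space := CSpace { c_val :> cseq R; c_valP : c_val \in c_pred }.
Record c0_space := C0Space { c0_val :> cseq R; c0_valP : c0_val \in c0_pred }.

HB.instance Definition _ := [isSub for c_val].
HB.instance Definition _ := [Choice of c_space by <:].
HB.instance Definition _ := [SubChoice_isSubLmodule of c_space by <:].

HB.instance Definition _ := [isSub for c0_val].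
HB.instance Definition _ := [Choice of c0_space by <:].
HB.instance Definition _ := [SubChoice_isSubLmodule of c0_space by <:].

Lemma c_cvgn (x : c_space) : cvgn (x : cseq R).
Proof. exact/asboolP/(c_valP x). Qed.

Lemma c0_cvg (x : c0_space) : (x : cseq R) @ \oo --> (0 : R[i]^o).
Proof. exact/asboolP/(c0_valP x). Qed.

Lemma c0_cvgn (x : c0_space) : cvgn (x : cseq R).
Proof. by apply/cvg_ex; exists 0; exact: c0_cvg. Qed.

Lemma c_normD (x y : c_space) :
  supnorm (x + y : c_space) <= supnorm x + supnorm y.
Proof. exact: (supnormD (@c_cvgn x) (@c_cvgn y)). Qed.

Lemma c_normZ l (x : c_space) : supnorm (l *: x : c_space) = `|l| * supnorm x.
Proof. exact: (supnormZ l (@c_cvgn x)). Qed.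

Lemma c_norm0 (x : c_space) : supnorm x = 0 -> x = 0.
Proof. by move=> x0; apply: val_inj; exact: (supnorm0_eq0 (@c_cvgn x)). Qed.

HB.instance Definition _ :=
  Lmodule_isNormed.Build R[i] c_space c_normD c_normZ c_norm0.

Lemma c0_normD (x y : c0_space) :
  supnorm (x + y : c0_space) <= supnorm x + supnorm y.
Proof. exact: (supnormD (@c0_cvgn x) (@c0_cvgn y)). Qed.

Lemma c0_normZ l (x : c0_space) :
  supnorm (l *: x : c0_space) = `|l| * supnorm x.
Proof. exact: (supnormZ l (@c0_cvgn x)). Qed.

Lemma c0_norm0 (x : c0_space) : supnorm x = 0 -> x = 0.
Proof. by move=> x0; apply: val_inj; exact: (supnorm0_eq0 (@c0_cvgn x)). Qed.

HB.instance Definition _ :=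
  Lmodule_isNormed.Build R[i] c0_space c0_normD c0_normZ c0_norm0.

End Spaces.

Section Operator.
Variable R : realType.
Implicit Types (A : nat -> nat -> R) (x : cseq R).

Lemma cvg_real_complex (u : nat -> R) (l : R) :
  u @ \oo --> l -> ((u n)%:C : R[i]^o) @[n --> \oo] --> (l%:C : R[i]^o).
Proof.
move=> /cvgrPdist_lt ul; apply/cvgrPdist_lt => e e0.
have eE : (complex.Re e)%:C = e by rewrite RRe_real// gtr0_real.
have re0 : 0 < complex.Re e by rewrite -ltcR eE.
have := ul _ re0; apply: filterS => n /=.
by rewrite -rmorphB -ltcR eE normc_def/= expr0n addr0 sqrtr_sqr.
Qed.

Lemma is_cvg_mxact A x i : stochastic A -> cvgn x ->
  cvgn (series (fun j => (A i j)%:C * x j : R[i]^o)).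
Proof.
move=> [A0 A1] /cvgn_bounded[M xM].
have realP (f : nat -> R) : (forall j, `|f j| <= M) ->
    cvgn (series (fun j => A i j * f j)).
  move=> fM; apply: normed_cvg.
  apply: (@series_le_cvg _ _ (fun j => A i j * M)) => [n|n|n|].
  - by rewrite normr_ge0.
  - by rewrite mulr_ge0// (le_trans _ (fM 0%N)).
  - by rewrite /= normrM ger0_norm// ler_wpM2l.
  - have : cvgn (series (M *: A i)).
      by apply: is_cvg_seriesZ; apply/cvg_ex; exists 1.
    by congr (cvgn (series _)); apply/funext => j; rewrite mulrC.
have reM (z : R[i]) m : complex.Re `|z| <= m -> `|complex.Re z| <= m.
  move=> zm; apply: le_trans zm; rewrite -lecR RRe_real ?normr_real//.
  exact: normc_ge_Re.
have imM (z : R[i]) m : complex.Re `|z| <= m -> `|complex.Im z| <= m.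
  by move=> zm; rewrite -normrN -ReiNIm reM// normrM complexiE normCi mulr1.
pose u := series (fun j => A i j * complex.Re (x j)).
pose v := series (fun j => A i j * complex.Im (x j)).
have -> : series (fun j => (A i j)%:C * x j : R[i]^o) =
    fun n => (u n)%:C + 'i%C * (v n)%:C.
  apply/funext => n; rewrite /u /v /series/= !rmorph_sum mulr_sumr -big_split/=.
  apply: eq_bigr => j _; rewrite [in LHS](complexE (x j)) !rmorphM/=.
  by rewrite mulrDr; congr (_ + _); rewrite mulrCA.
apply: is_cvgD.
  by apply/cvg_ex; eexists; apply: cvg_real_complex; apply: realP => j; exact: reM.
apply: is_cvgMr.
by apply/cvg_ex; eexists; apply: cvg_real_complex; apply: realP => j; exact: imM.
Qed.

Lemma mxact_linear A l x y : stochastic A -> cvgn x -> cvgn y ->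
  mxact A (l *: x + y) = l *: mxact A x + mxact A y.
Proof.
move=> sA cx cy; apply/funext => i.
have cAx := @is_cvg_mxact A x i sA cx; have cAy := @is_cvg_mxact A y i sA cy.
pose f z : cseq R := fun j => (A i j)%:C * z j.
have fE : f (l *: x + y) = l *: f x + f y.
  by apply/funext => j; rewrite /f !fctE mulrDr scalerAr.
have cl : cvgn (series (l *: f x)) := is_cvg_seriesZ (k := l) cAx.
transitivity (limn (series (f (l *: x + y)))); first by [].
rewrite fE (lim_seriesD cl cAy) (lim_seriesZ l cAx).
by [].
Qed.

Definition acts_on_c A := forall x, cvgn x -> cvgn (mxact A x).

Definition acts_on_c0 A := forall x,
  x @ \oo --> (0 : R[i]^o) -> mxact A x @ \oo --> (0 : R[i]^o).

Section Restriction.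
Variables (A : nat -> nat -> R) (sA : stochastic A).
Variables (Ac : acts_on_c A) (Ac0 : acts_on_c0 A).

(* The stochasticity argument is not used by the function itself, only by its
   linear instance. *)
Definition c_op (_ : stochastic A) (x : c_space R) : c_space R :=
  @CSpace R (mxact A x) (asboolT (Ac (@c_cvgn R x))).

Definition c0_op (_ : stochastic A) (x : c0_space R) : c0_space R :=
  @C0Space R (mxact A x) (asboolT (Ac0 (@c0_cvg R x))).

Lemma c_op_linear : linear (c_op sA).
Proof.
move=> l x y; apply: val_inj.
exact: (@mxact_linear A l x y sA (@c_cvgn R x) (@c_cvgn R y)).
Qed.

Lemma c0_op_linear : linear (c0_op sA).
Proof.
move=> l x y; apply: val_inj.
exact: (@mxact_linear A l x y sA (@c0_cvgn R x) (@c0_cvgn R y)).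
Qed.

HB.instance Definition _ :=
  GRing.isLinear.Build R[i] (c_space R) (c_space R) _ (c_op sA) c_op_linear.

HB.instance Definition _ :=
  GRing.isLinear.Build R[i] (c0_space R) (c0_space R) _ (c0_op sA) c0_op_linear.

End Restriction.

End Operator.

(* Main.v *)
(* On both spaces A is a contraction carrying a nonzero invariant functional phi:
   on c a limit of the Cesaro means of (A^k z)_0, equal to 1 at the constant
   sequence 1; on c_0 the pairing with the invariant distribution. If x were a
   supercyclic vector then phi x <> 0 by density, and l A^m x close to a nonzero
   y in ker phi would force l phi(x) = phi(l A^m x), hence l, to be small; as
   |A^m x| <= |x|, this makes y arbitrarily small.
   To avoid a Banach limit on c, phi is kept as an asymptotically invariant
   sequence phi_n, and y is made to have phi_n y frequently close to 0. *)
Require Import Defs.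
From HB Require Import structures.
From mathcomp Require Import all_boot all_order all_algebra.
From mathcomp Require Import all_classical all_reals all_analysis.
From mathcomp Require Import complex.
From mathcomp Require Import ring.

Set Implicit Arguments.
Unset Strict Implicit.
Unset Printing Implicit Defensive.

Import Order.TTheory GRing.Theory Num.Theory.
Import numFieldNormedType.Exports.

Local Open Scope classical_set_scope.
Local Open Scope ring_scope.
Local Open Scope complex_scope.

(** * A non-supercyclicity criterion for contractions *)

Section ComplexSequences.
Variable R : realType.

Lemma Re_norm (V : normedModType R[i]) (z : V) : (complex.Re `|z|)%:C = `|z|.
Proof. by rewrite RRe_real ?normr_real. Qed.

(** By compactness of the square of side [2 * M] the pairs of real and imaginary parts have a
    cluster point. Allowing any eventual property [P] lets one index meet several asymptotic
    conditions at once, without passing to a subsequence. *)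
Lemma bounded_frequently_close (u : nat -> R[i]) (M : R) :
    (forall n, `|u n| <= M%:C) ->
  exists c : R[i], forall (e : R[i]) (P : set nat), 0 < e ->
    (\forall n \near \oo, P n) -> exists2 n, P n & `|u n - c| < e.
Proof.
move=> uM.
have ReM n : complex.Re (u n) \in `[- M, M].
  by rewrite in_itv/= -ler_norml -lecR (le_trans _ (uM n))// normc_ge_Re.
have ImM n : complex.Im (u n) \in `[- M, M].
  rewrite in_itv/= -ler_norml -lecR (le_trans _ (uM n))//.
  by rewrite -normrN -ReiNIm (le_trans (normc_ge_Re _))// normrM complexiE normCi mulr1.
pose v n : R * R := (complex.Re (u n), complex.Im (u n)).
have cptM := @segment_compact R (- M) M.
have vM : (v @ \oo) (`[- M, M]%classic `*` `[- M, M]%classic).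
  by exists 0%N => // n _; split; [exact: ReM|exact: ImM].
have [[a b] [_ ab]] := compact_setX cptM cptM _ vM.
exists (a +i* b) => e P e0 oP.
have eE : (complex.Re e)%:C = e by rewrite RRe_real// gtr0_real.
have re0 : 0 < complex.Re e / 2 by rewrite divr_gt0// -ltcR eE.
have oQ : (v @ \oo) [set v n | n in P].
  by apply: filterS oP => n Pn; exists n.
(* Balls of a product are products of balls: each coordinate contributes less than [e / 2] to the
   modulus. *)
have [_ [[n Pn <-] [/= na nb]]] := ab _ _ oQ (nbhsx_ballx (a, b) _ re0).
exists n => //.
have -> : u n - (a +i* b) =
    (complex.Re (u n) - a)%:C + 'i%C * (complex.Im (u n) - b)%:C.
  by rewrite {1}[u n]complexE [a +i* b]complexE !rmorphB/=; ring.
rewrite (le_lt_trans (ler_normD _ _))// normrM complexiE normCi mul1r.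
rewrite !normc_def/= !expr0n/= !addr0 !sqrtr_sqr -rmorphD -eE ltcR.
rewrite (splitr (complex.Re e)) ltrD//.
  by move: na; rewrite /ball/= distrC.
by move: nb; rewrite /ball/= distrC.
Qed.

End ComplexSequences.

(** The vector [w] normalizes the functionals, and [v] lies off the line of [w]. With [c] a cluster
    point of [phi n v], the vector [v - c *: w] is nonzero and nearly annihilated by [phi n] for
    infinitely many [n]. *)
Lemma contraction_not_supercyclic (R : realType) (X : normedModType R[i])
    (T : {linear X -> X}) (phi : nat -> {linear X -> R[i]^o}) (w v : X) :
    (forall x, `|T x| <= `|x|) ->
    (forall n x, `|phi n x| <= `|x|) ->
    (forall x, phi n (T x) - phi n x @[n --> \oo] --> (0 : R[i]^o)) ->
    (forall n, phi n w = 1) -> (forall c : R[i], v != c *: w) ->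
  ~ supercyclic T.
Proof.
move=> TC phiC phiT phiw vw [x xd].
have approx y (e : R[i]) : 0 < e ->
    exists l m, `|y - l *: iter m T x| < e.
  move=> e0; have [|z [/= ye [l _ [m _ E]]]] := xd (ball y e) _ (ball_open y e).
    by exists y; exact: ballxx.
  by exists l, m; move: E => /= ->; move: ye; rewrite -ball_normE.
have phi_iter m : phi n (iter m T x) - phi n x @[n --> \oo] --> (0 : R[i]^o).
  elim: m => [|m IH] /=.
    by under eq_fun do rewrite subrr; exact: cvg_cst.
  rewrite [X in X @ _ --> _](_ : _ =
      (fun n => phi n (T (iter m T x)) - phi n (iter m T x)) +
      (fun n => phi n (iter m T x) - phi n x)); last first.
    by apply/funext => n; rewrite fctE addrA subrK.
  by rewrite -[X in _ --> X](addr0 0); exact: cvgD (phiT _) IH.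
have iterC m : `|iter m T x| <= `|x|.
  by elim: m => //= m; exact: le_trans.
have [l0 [m0 wl0]] : exists l m, `|w - l *: iter m T x| < 2^-1 :> R[i].
  by apply: approx; rewrite invr_gt0.
(* Applying [phi n] to the approximation of [w] gives [1 <= 1/2 + 1/4 + |l0 *: phi n x|] for large
   [n], where [1/4] bounds the drift of [phi n] along the orbit; hence the factor 4. *)
pose K : R[i] := 4 * `|l0|.
have phix : \forall n \near \oo, 1 <= K * `|phi n x|.
  have cvg0 : l0 *: (phi n (iter m0 T x) - phi n x) @[n --> \oo] -->
      (0 : R[i]^o).
    by rewrite -[X in _ --> X](scaler0 _ l0); exact: cvgZl_tmp (phi_iter m0).
  have e0 : 0 < 4^-1 :> R[i] by rewrite invr_gt0.
  apply: filterS (cvgr0_norm_lt _ cvg0 _ e0) => n lt4.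
  have lt2 : `|1 - l0 *: phi n (iter m0 T x)| < 2^-1.
    rewrite -[X in X - _](phiw n) -linearZ -linearB.
    exact: le_lt_trans (phiC _ _) wl0.
  have : `|1 : R[i]| <= 2^-1 + 4^-1 + `|l0 *: phi n x|.
    rewrite [X in `|X| <= _](_ : (1 : R[i]) = (1 - l0 *: phi n (iter m0 T x)) +
        l0 *: (phi n (iter m0 T x) - phi n x) + l0 *: phi n x); last first.
      by rewrite scalerBr; ring.
    rewrite (le_trans (ler_normD _ _))// lerD2r (le_trans (ler_normD _ _))//.
    exact: lerD (ltW lt2) (ltW lt4).
  rewrite normr1 normrZ => h.
  have : 4^-1 <= `|l0| * `|phi n x|.
    rewrite -(lerD2l (2^-1 + 4^-1)) (le_trans _ h)//.
    by rewrite (_ : _ + _ = 1)//; field.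
  rewrite /K -mulrA => h4; apply: le_trans (ler_wpM2l _ h4); last by [].
  by rewrite mulfV// pnatr_eq0.
have vM n : `|phi n v| <= (complex.Re `|v|)%:C by rewrite Re_norm.
have [c phivc] := bounded_frequently_close vM.
pose y := v - c *: w.
have y0 : 0 < `|y| by rewrite normr_gt0 subr_eq0.
have K0 : 0 <= K by rewrite mulr_ge0.
(* Solves [e + K * (3 * e) * |x| = |y|], the left side being the strict upper bound for [|y|]
   reached at the end. *)
pose e := `|y| / (1 + 3 * K * `|x|).
have D0 : 0 < 1 + 3 * K * `|x| by rewrite ltr_wpDr// !mulr_ge0.
have e0 : 0 < e by rewrite divr_gt0.
have [l [m yl]] := approx y e e0.
have cvg0 : l *: (phi n (iter m T x) - phi n x) @[n --> \oo] --> (0 : R[i]^o).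
  by rewrite -[X in _ --> X](scaler0 _ l); exact: cvgZl_tmp (phi_iter m).
have [n [lt1 lt2] lt3] := phivc _ _ e0 (filterI phix (cvgr0_norm_lt _ cvg0 _ e0)).
(* Three errors of size [e]: [phi n v] against [c], the approximation of [y], and the drift of
   [phi n] from [x] to [iter m T x]. *)
have le3 : `|l| * `|phi n x| <= 3 * e.
  rewrite -normrZ.
  have -> : l *: phi n x = (phi n v - c) - phi n (y - l *: iter m T x)
      - l *: (phi n (iter m T x) - phi n x).
    rewrite /y !linearB !linearZ /= phiw /GRing.scale/=. ring.
  rewrite (le_trans (ler_normB _ _))//.
  rewrite (_ : 3 * e = e + e + e); last by ring.
  rewrite lerD ?(ltW lt2)// (le_trans (ler_normB _ _))// lerD ?(ltW lt3)//.
  by rewrite (le_trans (phiC _ _))// ltW.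
have lK : `|l| <= K * (3 * e).
  rewrite (le_trans _ (ler_wpM2l K0 le3))// mulrCA -[leLHS]mulr1.
  by rewrite ler_wpM2l.
suff : `|y| < `|y| by rewrite ltxx.
rewrite [ltRHS](_ : `|y| = e + K * (3 * e) * `|x|); last first.
  have -> : e + K * (3 * e) * `|x| = e * (1 + 3 * K * `|x|) by ring.
  by rewrite /e divfK// gt_eqF.
rewrite -{1}[y](subrK (l *: iter m T x)) (le_lt_trans (ler_normD _ _))//.
by rewrite ltr_leD// normrZ ler_pM.
Qed.

(** * Cesaro means of a functional along orbits *)

Section CesaroMean.
Variables (R : realType) (X : normedModType R[i]).
Variables (T : {linear X -> X}) (psi : {linear X -> R[i]^o}).

Definition cesaro_mean n (x : X) : R[i]^o :=
  n.+1%:R^-1 * \sum_(k < n.+1) psi (iter k T x).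

Lemma cesaro_mean_linear n : linear (cesaro_mean n).
Proof.
move=> l x y; rewrite /cesaro_mean /GRing.scale/= mulrCA -mulrDr; congr (_ * _).
rewrite mulr_sumr -big_split/=; apply: eq_bigr => k _.
suff -> : iter k T (l *: x + y) = l *: iter k T x + iter k T y by rewrite linearP.
by elim: (nat_of_ord k) => //= m ->; rewrite linearP.
Qed.

HB.instance Definition _ n :=
  GRing.isLinear.Build R[i] X R[i]^o _ (cesaro_mean n) (cesaro_mean_linear n).

Hypothesis TC : forall x, `|T x| <= `|x|.
Hypothesis psiC : forall x, `|psi x| <= `|x|.

Let iterC k x : `|psi (iter k T x)| <= `|x|.
Proof.
by rewrite (le_trans (psiC _))//; elim: k => //= k; exact: le_trans.
Qed.

Lemma cesaro_mean_le n x : `|cesaro_mean n x| <= `|x|.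
Proof.
rewrite normrM normfV normr_nat ler_pdivrMl// (le_trans (ler_norm_sum _ _ _))//.
apply: le_trans (ler_sum _ (fun (k : 'I_n.+1) _ => iterC k x)) _.
by rewrite sumr_const card_ord mulr_natl.
Qed.

(** The difference telescopes to [psi (iter n.+1 T x) - psi x] divided by [n.+1], of modulus at most
    [2 * |x| / n.+1]. *)
Lemma cesaro_mean_invariant x :
  cesaro_mean n (T x) - cesaro_mean n x @[n --> \oo] --> (0 : R[i]^o).
Proof.
apply/cvgrPdist_le => e e0.
have eE : (complex.Re e)%:C = e by rewrite RRe_real// gtr0_real.
have re0 : 0 < complex.Re e by rewrite -ltcR eE.
pose B := complex.Re `|x| *+ 2 / complex.Re e.
exists (Num.truncn B) => // n /= Bn.
rewrite sub0r normrN /cesaro_mean -mulrBr -sumrB.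
under eq_bigr do rewrite -iterSr.
rewrite -(big_mkord xpredT (fun k => psi (iter k.+1 T x) - psi (iter k T x))).
rewrite telescope_sumr//= normrM normfV normr_nat ler_pdivrMl//.
rewrite (le_trans (ler_normB _ _))//.
rewrite (le_trans (lerD (iterC n.+1 x) (iterC 0 x)))// -mulr2n.
rewrite -[`|x|]Re_norm -eE -(rmorphMn (real_complex R)).
rewrite -(rmorph_nat (real_complex R)) -rmorphM lecR.
by rewrite -ler_pdivrMr// ltW// (lt_le_trans (truncnS_gt _))// ler_nat ltnS.
Qed.

Lemma contraction_fixpoint_not_supercyclic (w v : X) :
  T w = w -> psi w = 1 -> (forall c : R[i], v != c *: w) -> ~ supercyclic T.
Proof.
move=> Tw psiw vw.
apply: (@contraction_not_supercyclic _ _ _ cesaro_mean w v) => //.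
- exact: cesaro_mean_le.
- exact: cesaro_mean_invariant.
- move=> n; rewrite /= /cesaro_mean (eq_bigr (fun=> 1)) => [|k _].
    by rewrite sumr_const card_ord mulVf// pnatr_eq0.
  by rewrite iter_fix.
Qed.

(** When [psi] itself is invariant, the constant sequence [psi] serves as [phi], after rescaling
    [w]. *)
Lemma contraction_invariant_not_supercyclic (w v : X) :
    (forall x, psi (T x) = psi x) -> psi w != 0 ->
  (forall c : R[i], v != c *: w) -> ~ supercyclic T.
Proof.
move=> psiT psiw vw.
apply: (@contraction_not_supercyclic _ _ _ (fun=> psi) ((psi w)^-1 *: w) v) => //.
- by move=> x; under eq_fun do rewrite psiT subrr; exact: cvg_cst.
- by move=> _; rewrite linearZ; exact: mulVf.
- by move=> c; rewrite scalerA.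
Qed.

End CesaroMean.

(** * Stochastic matrices acting on convergent sequences *)

Section StochasticOperator.
Variable R : realType.
Implicit Types (A : nat -> nat -> R) (x : cseq R).

Lemma limn_norm_le (s : nat -> R[i]^o) (M : R[i]) :
  cvgn s -> (forall n, `|s n| <= M) -> `|limn s| <= M.
Proof.
move=> /cvgrPdist_le cs sM; apply/ler_addgt0Pr => e e0.
have [N _ /(_ N (leqnn N)) sN] := cs e e0.
rewrite -(subrK (s N) (limn s)) addrC (le_trans (ler_normD _ _))//.
exact: lerD.
Qed.

(** The partial sums of a row increase to 1, so every partial sum of the defining series already has
    modulus at most [M]. This yields the contraction property on both spaces. *)
Lemma mxact_le A x (M : R[i]) i : stochastic A -> cvgn x ->
  (forall n, `|x n| <= M) -> `|mxact A x i| <= M.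
Proof.
move=> sA cx xM; apply: limn_norm_le; first exact: is_cvg_mxact.
have [A0 A1] := sA.
have M0 : 0 <= M by apply: le_trans (xM 0%N).
move=> n; rewrite /series/= (le_trans (ler_norm_sum _ _ _))//.
have A_le : series (A i) n <= 1.
  rewrite -(cvg_lim (@Rhausdorff R) (A1 i)); apply: nondecreasing_cvgn_le.
    by apply: nondecreasing_series => k _ _; exact: A0.
  by apply/cvg_ex; exists 1.
apply: (@le_trans _ _ ((series (A i) n)%:C * M)); last first.
  by rewrite -[leRHS]mul1r ler_wpM2r// -[1]/(1%:C) lecR.
rewrite /series/= rmorph_sum mulr_suml ler_sum// => k _.
by rewrite normrM ger0_norm ?ler0c// ler_wpM2l ?ler0c.
Qed.

Definition delta j : cseq R := fun i => (i == j)%:R.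

Lemma delta_cvg0 j : delta j @ \oo --> (0 : R[i]^o).
Proof.
apply: cvg_near_cst; exists j.+1 => // n /= jn.
by rewrite /delta gtn_eqF.
Qed.

Lemma mxact_delta A i j : mxact A (delta j) i = (A i j)%:C.
Proof.
apply: cvg_lim; first exact: norm_hausdorff.
apply: cvg_near_cst; exists j.+1 => // n /= jn.
rewrite /series/= (bigD1_seq j)/= ?mem_index_iota ?iota_uniq//.
rewrite /delta eqxx mulr1 big1 ?addr0// => k kj.
by rewrite (negbTE kj) mulr0.
Qed.

Lemma mxact1 A : stochastic A -> mxact A (fun=> 1) = fun=> 1.
Proof.
move=> [_ A1]; apply/funext => i; apply: cvg_lim; first exact: norm_hausdorff.
suff -> : series (fun j => (A i j)%:C * 1 : R[i]^o) =
    fun n => (series (A i) n)%:C by exact: cvg_real_complex (A1 i).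
apply/funext => n; rewrite /series/= rmorph_sum.
by apply: eq_bigr => j _; rewrite mulr1.
Qed.

End StochasticOperator.

(** * The operator on c *)

Section ConvergentSequences.
Variables (R : realType) (A : nat -> nat -> R).
Hypotheses (sA : stochastic A) (Ac : acts_on_c A).

Lemma c_norm_ge (x : c_space R) n : `|(x : cseq R) n| <= `|x|.
Proof. exact: supnorm_ge (@c_cvgn R x). Qed.

Lemma c_op_contraction (x : c_space R) : `|c_op Ac sA x| <= `|x|.
Proof.
apply: supnorm_le => n; apply: mxact_le => //; first exact: c_cvgn.
exact: c_norm_ge.
Qed.

Definition c_eval0 (x : c_space R) : R[i]^o := (x : cseq R) 0%N.

Lemma c_eval0_linear : linear c_eval0. Proof. by []. Qed.

HB.instance Definition _ :=
  GRing.isLinear.Build R[i] (c_space R) R[i]^o _ c_eval0 c_eval0_linear.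

Lemma c_op_not_supercyclic :
  ~ supercyclic (c_op Ac sA : {linear c_space R -> c_space R}).
Proof.
have c1 : (fun=> 1 : R[i]^o) \in @c_pred R by apply/asboolP; exact: is_cvg_cst.
have cd : @delta R 0 \in @c_pred R.
  by apply/asboolP/cvg_ex; exists 0; exact: delta_cvg0.
(* The fixed vector is the constant sequence 1; coordinates 0 and 1 show that [delta 0] is not a
   multiple of it. *)
apply: (@contraction_fixpoint_not_supercyclic _ _ _ c_eval0 c_op_contraction
  (fun x => c_norm_ge x 0) (CSpace c1) (CSpace cd)) => //.
- by apply: val_inj; exact: mxact1.
- move=> c; apply/eqP => /(congr1 (fun x : c_space R => (x : cseq R))) E.
  have E0 : 1 = c * 1 := congr1 (@^~ 0%N) E.
  have E1 : 0 = c * 1 := congr1 (@^~ 1%N) E.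
  by have /eqP := etrans E0 (esym E1); rewrite oner_eq0.
Qed.

End ConvergentSequences.

(** * The operator on c_0 and the invariant distribution *)

Section NullSequences.
Variables (R : realType) (A : nat -> nat -> R).
Hypotheses (sA : stochastic A) (Ac0 : acts_on_c0 A).

Lemma c0_norm_ge (x : c0_space R) n : `|(x : cseq R) n| <= `|x|.
Proof. exact: supnorm_ge (@c0_cvgn R x). Qed.

Lemma c0_op_contraction (x : c0_space R) : `|c0_op Ac0 sA x| <= `|x|.
Proof.
apply: supnorm_le => n; apply: mxact_le => //; first exact: c0_cvgn.
exact: c0_norm_ge.
Qed.

Definition c0_delta j : c0_space R := C0Space (asboolT (@delta_cvg0 R j)).

(** Truncation leaves only a uniformly small tail. This density of finitely supported sequences
    reduces invariance of the pairing to the unit vectors. *)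
Lemma c0_delta_approx (x : c0_space R) (e : R) : 0 < e ->
  exists N, `|x - \sum_(j < N) (x : cseq R) j *: c0_delta j| <= e%:C.
Proof.
move=> e0; have e0C : 0 < e%:C by rewrite ltcR.
have [N _ xN] := cvgr0_norm_le _ (@c0_cvg R x) _ e0C.
exists N; apply: supnorm_le => n.
have c0_sum (F : 'I_N -> c0_space R) :
    ((\sum_j F j : c0_space R) : cseq R) n = \sum_j (F j : cseq R) n.
  by elim/big_ind2 : _ => // a b c d ab cd; rewrite -ab -cd.
have -> : ((x - \sum_(j < N) (x : cseq R) j *: c0_delta j : c0_space R) : cseq R) n
    = (x : cseq R) n - \sum_(j < N) (x : cseq R) j * (n == j)%:R.
  exact: (congr1 (fun t : R[i]^o => (x : cseq R) n - t)
    (c0_sum (fun j => (x : cseq R) j *: c0_delta j))).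
have [nN|Nn] := ltnP n N.
  rewrite (bigD1 (Ordinal nN))//= eqxx mulr1 big1 ?addr0 ?subrr ?normr0 ?ltW//.
  by move=> j; rewrite -val_eqE eq_sym /= => /negbTE ->; rewrite mulr0.
rewrite big1 ?subr0; first exact: xN.
by move=> j _; rewrite gtn_eqF ?mulr0// (leq_trans (ltn_ord j)).
Qed.

Variable u : nat -> R.
Hypotheses (u0 : forall i, 0 <= u i) (u1 : series u @ \oo --> (1 : R)).
Hypothesis uA : forall j, series (fun i => u i * A i j) @ \oo --> u j.

Let U (_ : nat) := u.

Let sU : stochastic U. Proof. by split. Qed.

(* Encoding the pairing with u as the action of the matrix all of whose rows
   are u makes the facts on stochastic matrices available for it. *)
Definition c0_pairing (x : c0_space R) : R[i]^o := mxact (fun=> u) x 0%N.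

Lemma c0_pairing_linear : linear c0_pairing.
Proof.
move=> l x y.
have E := mxact_linear l sU (@c0_cvgn R x) (@c0_cvgn R y).
exact: (congr1 (fun z : cseq R => z 0%N) E).
Qed.

HB.instance Definition _ :=
  GRing.isLinear.Build R[i] (c0_space R) R[i]^o _ c0_pairing c0_pairing_linear.

Lemma c0_pairing_le (x : c0_space R) : `|c0_pairing x| <= `|x|.
Proof.
apply: (mxact_le (A := U)) => //; first exact: c0_cvgn.
exact: c0_norm_ge.
Qed.

Lemma c0_pairing_delta j : c0_pairing (c0_delta j) = (u j)%:C.
Proof. exact: mxact_delta. Qed.

(** [A] sends the unit vector to its column [j], whose pairing with [u] is coordinate [j] of
    [uA]. *)
Lemma c0_pairing_op_delta j : c0_pairing (c0_op Ac0 sA (c0_delta j)) = (u j)%:C.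
Proof.
apply: cvg_lim; first exact: norm_hausdorff.
rewrite [X in X @ _ --> _](_ : _ = fun n => (series (fun i => u i * A i j) n)%:C).
  exact: cvg_real_complex.
apply/funext => n; rewrite /series/= rmorph_sum.
by apply: eq_bigr => i _; rewrite mxact_delta rmorphM.
Qed.

Lemma c0_pairing_op (x : c0_space R) :
  c0_pairing (c0_op Ac0 sA x) = c0_pairing x.
Proof.
apply/eqP; rewrite -subr_eq0 -normr_le0; apply/ler_addgt0Pr => e e0.
have eE : (complex.Re e)%:C = e by rewrite RRe_real// gtr0_real.
have re0 : 0 < complex.Re e / 2 by rewrite divr_gt0// -ltcR eE.
have [N] := c0_delta_approx x re0; set y := \sum_(j < N) _ => xy.
have Ty : c0_pairing (c0_op Ac0 sA y) = c0_pairing y.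
  rewrite /y !linear_sum/=; apply: eq_bigr => j _.
  by rewrite !linearZ/= c0_pairing_op_delta c0_pairing_delta.
have -> : c0_pairing (c0_op Ac0 sA x) - c0_pairing x =
    c0_pairing (c0_op Ac0 sA (x - y)) - c0_pairing (x - y).
  by rewrite !linearB/= Ty; ring.
(* Since [A] and the pairing are contractions, the truncation error [x - y] costs at most [e / 2] in
   each of the two terms. *)
rewrite add0r (le_trans (ler_normB _ _))// -eE (splitr (complex.Re e)) rmorphD.
apply: lerD; first apply: le_trans (c0_pairing_le _) _.
  exact: le_trans (c0_op_contraction _) xy.
exact: le_trans (c0_pairing_le _) xy.
Qed.

Lemma c0_op_not_supercyclic :
  ~ supercyclic (c0_op Ac0 sA : {linear c0_space R -> c0_space R}).
Proof.
have [j uj] : exists j, u j != 0.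
  apply/not_existsP => u_eq0; have := oner_neq0 R.
  suff -> : (1 : R) = 0 by rewrite eqxx.
  rewrite -(cvg_lim (@Rhausdorff R) u1); apply: cvg_lim; first exact: Rhausdorff.
  apply: cvg_near_cst; apply: nearW => n; rewrite /series/= big1// => k _.
  by have /negP/negPn/eqP := u_eq0 k.
(* The pairing takes the nonzero value [u j] at [c0_delta j]; any other unit vector lies off its
   line. *)
apply: (@contraction_invariant_not_supercyclic _ _ _ c0_pairing
  c0_op_contraction c0_pairing_le (c0_delta j) (c0_delta j.+1)).
- exact: c0_pairing_op.
- by rewrite /= c0_pairing_delta fmorph_eq0.
- move=> c; apply/eqP => /(congr1 (fun x : c0_space R => (x : cseq R) j.+1)) E.
  have : (j.+1 == j.+1)%:R = c * (j.+1 == j)%:R := E.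
  by rewrite eqxx gtn_eqF// mulr0 => /eqP; rewrite oner_eq0.
Qed.

End NullSequences.

Theorem proposition3p1 (R : realType) (A : nat -> nat -> R)
    (sA : stochastic A) (irrA : irreducible A) :
  (forall Ac : acts_on_c A,
      ~ supercyclic (c_op Ac sA : {linear c_space R -> c_space R})) /\
  (positive_recurrent A ->
    forall Ac0 : acts_on_c0 A,
      ~ supercyclic (c0_op Ac0 sA : {linear c0_space R -> c0_space R})).
Proof.
split; first exact: c_op_not_supercyclic.
by move=> [u [u0 u1 uA]] Ac0; exact: c0_op_not_supercyclic u0 u1 uA.
Qed.
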